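(* Let $\kappa$ be a regular uncountable cardinal. Then $\mathrm{HP}(\kappa)$ implies both $\mathrm{C}^{\mathrm s}(\kappa)$ and $\hat{\mathrm C}^{\mathrm s}(\kappa)$.
   Context: Notation. For a set $X$ and $n\in\omega$, $((X))^n$ is the set of injective $n$-tuples of elements of $X$, and $((X))^{<\omega}=\bigcup_{n<\omega}((X))^n$. For sets $X_0,\dots,X_{n-1}$, $((X_0,\dots,X_{n-1}))$ is the set of injective tuples in $X_0\times\cdots\times X_{n-1}$. $f''S$ is the image of $S$ under $f$. ${}^{\omega>}\omega$ is the set of finite sequences of natural numbers, $|t|$ is the length of $t$, and an intersection of subsets of $\omega$ over an empty index set is read as $\omega$. $\mathcal H(\aleph_1)$ is the set of hereditarily countable sets. A set $A\subseteq\mathcal H(\aleph_1)$ is definable if there are a formula $\varphi$ of the language of set theory and $a\in\mathcal H(\aleph_1)$ with $A=\{x\in\mathcal H(\aleph_1):\langle\mathcal H(\aleph_1),\in\rangle\models\varphi(x,a)\}$. $\mathrm{HP}(\kappa)$: for any $f:\kappa\to\mathcal P(\omega)$ and any definable $A\subseteq((\mathcal P(\omega)))^{<\omega}$, at least one of the following holds: (h0) there is a stationary $S\subseteq\kappa$ such that $((f''S))^{<\omega}\setminus\{\emptyset\}\subseteq A$; (h1) there are $k\in\omega\setminus\{0\}$ and stationary $S_0,\dots,S_{k-1}\subseteq\kappa$ such that $((f''S_0,\dots,f''S_{k-1}))\cap A=\emptyset$. $\mathrm C^{\mathrm s}(\kappa)$: for any matrix $\langle a_{\alpha,n}:\alpha\in\kappa,n\in\omega\rangle$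 of subsets of $\omega$ and any $T\subseteq{}^{\omega>}\omega$, at least one of the following holds: (c0) there is a stationary $S\subseteq\kappa$ such that $\bigcap_{n<|t|}a_{\alpha_n,t(n)}\neq\emptyset$ for all $t\in T$ and $\langle\alpha_0,\dots,\alpha_{|t|-1}\rangle\in((S))^{|t|}$; (c1) there are $t\in T$ and stationary $S_0,\dots,S_{|t|-1}\subseteq\kappa$ such that $\bigcap_{n<|t|}a_{\alpha_n,t(n)}=\emptyset$ for all $\langle\alpha_0,\dots,\alpha_{|t|-1}\rangle\in((S_0,\dots,S_{|t|-1}))$. $\hat{\mathrm C}^{\mathrm s}(\kappa)$: for any such matrix and $T$, at least one of the following holds: (ĉ0) there is a stationary $S\subseteq\kappa$ such that $\bigcap_{n<|t|}a_{\alpha_n,t(n)}$ is finite for every $t\in T$ and $\langle\alpha_0,\dots,\alpha_{|t|-1}\rangle\in((S))^{|t|}$; (ĉ1) there are $t\in T$ and stationary $S_0,\dots,S_{|t|-1}\subseteq\kappa$ such that $\bigcap_{n<|t|}a_{\alpha_n,t(n)}$ is infinite for every $\langle\alpha_0,\dots,\alpha_{|t|-1}\rangle\in((S_0,\dots,S_{|t|-1}))$. *)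

(* Defs.v *)
From HB Require Import structures.
From mathcomp Require Import all_boot all_order.
From mathcomp Require Import boolp classical_sets functions cardinality.

Set Implicit Arguments.
Unset Strict Implicit.
Unset Printing Implicit Defensive.

Import Order.TTheory.
Local Open Scope classical_set_scope.
Local Open Scope card_scope.

(* A regular uncountable cardinal is given as a type K ordered as an initial
   ordinal: subsets of K are subsets of the cardinal, and the proper initial
   segments of K are its elements. *)
Section Cardinals.
Context {d : Order.disp_t} (K : orderType d).
Implicit Types C S X : set K.

Definition initial_ordinal : Prop :=
  well_founded (fun x y : K => (x < y)%O) /\
  forall x : K, ~ ([set: K] #<= [set y : K | (y < x)%O]).

Definition unbounded X : Prop := forall x : K, exists2 y, X y & (x <= y)%O.

Definition regular : Prop := forall X, unbounded X -> [set: K] #<= X.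

Definition regular_uncountable_cardinal : Prop :=
  [/\ initial_ordinal, regular & ~ countable [set: K]].

(* The two conditions on x say that x is a nonzero limit point of C; the
   strict z < x makes x a limit ordinal. *)
Definition closed_in_order C : Prop :=
  forall x : K, (exists y : K, (y < x)%O) ->
    (forall y : K, (y < x)%O -> exists z, [/\ C z, (y < z)%O & (z < x)%O]) ->
    C x.

Definition club C : Prop := closed_in_order C /\ unbounded C.

Definition stationary S : Prop := forall C, club C -> S `&` C !=set0.

End Cardinals.

(* ((X))^{<omega} *)
Definition inj_seqs (T : eqType) (X : set T) : set (seq T) :=
  [set s | uniq s /\ forall x, x \in s -> X x].

(* ((X_0, ..., X_{n-1})) *)
Definition inj_prod (T : eqType) (n : nat) (X : 'I_n -> set T) :
    set (n.-tuple T) :=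
  [set s : n.-tuple T | uniq s /\ forall i, X i (tnth s i)].

(* ((X))^n *)
Definition inj_tuples (T : eqType) (n : nat) (X : set T) : set (n.-tuple T) :=
  inj_prod (fun _ : 'I_n => X).

(* Hereditarily countable sets: [hrange F] is the nonempty countable set
   {F n | n : nat}. A set has many such presentations, so equality is the
   extensional [heq], and H(aleph_1) is HC modulo [heq]. *)
Inductive HC : Type :=
  | hempty
  | hrange of (nat -> HC).

Fixpoint heq (x y : HC) {struct x} : Prop :=
  match x, y with
  | hempty, hempty => True
  | hrange F, hrange G =>
      (forall i : nat, exists j : nat, heq (F i) (G j)) /\
      (forall j : nat, exists i : nat, heq (F i) (G j))
  | _, _ => False
  end.

Definition hmem (x y : HC) : Prop :=
  match y with
  | hempty => False
  | hrange G => exists j : nat, heq x (G j)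
  end.

(* Formulas of the language of set theory, with de Bruijn indices; the other
   connectives are classically definable from these. *)
Inductive formula : Type :=
  | FMem of nat & nat
  | FEq of nat & nat
  | FNot of formula
  | FAnd of formula & formula
  | FEx of formula.

(* All free variables of p are among the first n. *)
Fixpoint free_below (n : nat) (p : formula) : bool :=
  match p with
  | FMem i j | FEq i j => (i < n) && (j < n)
  | FNot q => free_below n q
  | FAnd q r => free_below n q && free_below n r
  | FEx q => free_below n.+1 q
  end.

Definition scons (T : Type) (x : T) (v : nat -> T) (n : nat) : T :=
  if n is m.+1 then v m else x.

(* Truth of p in <H(aleph_1), \in> under the valuation v. *)
Fixpoint sat (v : nat -> HC) (p : formula) : Prop :=
  match p with
  | FMem i j => hmem (v i) (v j)
  | FEq i j => heq (v i) (v j)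
  | FNot q => ~ sat v q
  | FAnd q r => sat v q /\ sat v r
  | FEx q => exists x : HC, sat (scons x v) q
  end.

(* Variable 0 is x and variable 1 is the parameter a. *)
Definition definable (A : set HC) : Prop :=
  exists p : formula, exists a : HC, free_below 2 p /\
    forall x : HC, A x <-> sat (scons x (fun=> a)) p.

(* Finite sequences of subsets of omega as elements of H(aleph_1): von Neumann
   numerals, Kuratowski pairs, and sequences as functions on a numeral. *)
Definition hsucc (x : HC) : HC :=
  match x with
  | hempty => hrange (fun=> hempty)
  | hrange F => hrange (scons x F)
  end.

Definition hnat (n : nat) : HC := iter n hsucc hempty.

(* {F n | n in D} *)
Definition himage (F : nat -> HC) (D : set nat) : HC :=
  if `[< D !=set0 >] then hrange (fun n => F (if n \in D then n else get D))
  else hempty.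

Definition hreal (X : set nat) : HC := himage hnat X.

Definition hupair (x y : HC) : HC := hrange (scons x (fun=> y)).

Definition hpair (x y : HC) : HC := hupair (hupair x x) (hupair x y).

Definition hseq (s : seq (set nat)) : HC :=
  himage (fun i => hpair (hnat i) (hreal (nth set0 s i)))
    [set i : nat | (i < size s)%N].

Definition definable_seqs (A : set (seq (set nat))) : Prop :=
  definable [set x | exists2 s, A s & heq x (hseq s)].

Section Principles.
Context {d : Order.disp_t} (K : orderType d).

Definition HP : Prop :=
  forall (f : K -> set nat) (A : set (seq (set nat))),
    A `<=` inj_seqs [set: set nat] -> definable_seqs A ->
    (exists2 S : set K, stationary S & inj_seqs (f @` S) `\ [::] `<=` A) \/
    (exists k : nat, (0 < k)%N /\
      exists S : 'I_k -> set K, (forall i, stationary (S i)) /\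
        forall s : k.-tuple (set nat),
          inj_prod (fun i => f @` S i) s -> ~ A s).

(* Intersection of the a_{alpha_n, t(n)} for n < |t|; it is omega for t empty. *)
Definition matrix_cap (a : K -> nat -> set nat) (t : seq nat)
    (al : (size t).-tuple K) : set nat :=
  \bigcap_(n in [set: 'I_(size t)]) a (tnth al n) (tnth (in_tuple t) n).

Definition Cs : Prop :=
  forall (a : K -> nat -> set nat) (T : set (seq nat)),
    (exists2 S : set K, stationary S &
      forall t, T t -> forall al : (size t).-tuple K,
        inj_tuples S al -> matrix_cap a al !=set0) \/
    (exists2 t, T t & exists S : 'I_(size t) -> set K,
      (forall i, stationary (S i)) /\
      forall al : (size t).-tuple K,
        inj_prod S al -> matrix_cap a al = set0).

Definition Cs_hat : Prop :=
  forall (a : K -> nat -> set nat) (T : set (seq nat)),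
    (exists2 S : set K, stationary S &
      forall t, T t -> forall al : (size t).-tuple K,
        inj_tuples S al -> finite_set (matrix_cap a al)) \/
    (exists2 t, T t & exists S : 'I_(size t) -> set K,
      (forall i, stationary (S i)) /\
      forall al : (size t).-tuple K,
        inj_prod S al -> infinite_set (matrix_cap a al)).

End Principles.

(* Main.v *)
Require Import Defs.
From mathcomp Require Import all_boot all_order.
From mathcomp Require Import boolp classical_sets functions cardinality.

Set Implicit Arguments.
Unset Strict Implicit.
Unset Printing Implicit Defensive.

Import Order.TTheory.
Local Open Scope classical_set_scope.
Local Open Scope card_scope.

(** Both principles are instances of one dichotomy, in which a property Psi of
    subsets of omega (nonempty for the first principle, finite for the second)
    takes the place of the condition on the intersections
    (lemma [homogeneity_dichotomy]).

    Let [f alpha] be a real coding the row of index [alpha] of the matrix, and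
    apply HP to f and to a set A of finite injective sequences of reals.  The
    obvious A asks Psi for every t in T of length at most that of the sequence;
    but then (h1) only says that every tuple of a rectangle of stationary sets
    fails Psi for some t depending on the tuple, and shrinking the rectangle
    need not make t constant.  The remedy is to let each length test one t
    only.  Choose an injection [t |-> k_t] from sequences to positive
    numbers with |t| <= k_t, and let a sequence of length k_t be in A iff the
    intersection for t along its first |t| entries satisfies Psi; sequences of
    other lengths are all in A.  Then (h0) gives the first alternative, since
    an injective tuple of length |t| in a stationary set extends to one of
    length k_t.  In (h1) the length k of the rectangle must be k_t for some t
    in T, and the first |t| sides form a rectangle on which Psi fails for this
    t, since tuples in it again extend to length k.

    HP speaks of injective tuples of reals, the conclusion of injective tuples
    of indices.  A diagonal intersection argument ([constant_or_injective])
    shows that f is constant on a stationary set or injective on a club.  In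
    the first case the intersection for t is the same for all tuples and the
    dichotomy is immediate; in the second, one works inside the club.

    That A is definable in H(aleph_1) comes from a parameter coding omega, the
    set of lengths k_t with t in T, and a countable set of quadruples saying
    which numbers a sequence of length k must contain at which entry
    ([trace_class_definable]).  Formulas are never written out: predicates on
    valuations expressed by a formula are closed under the connectives and
    quantifiers. *)

(** * Extensional equality and membership in H(aleph_1) *)

Lemma heq_refl x : heq x x.
Proof. by elim: x => //= F IH; split=> i; exists i. Qed.

Lemma heq_sym x y : heq x y -> heq y x.
Proof.
elim: x y => [|F IH] [|G] //= [FG GF].
by split=> i; [have [j] := GF i | have [j] := FG i] => /IH; exists j.
Qed.

Lemma heq_trans x y z : heq x y -> heq y z -> heq x z.
Proof.
elim: x y z => [|F IH] [|G] [|H] //= [FG GF] [GH HG]; split=> i.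
  by have [j Fij] := FG i; have [l Gjl] := GH j; exists l; apply: IH Gjl.
by have [j Gji] := HG i; have [l Flj] := GF j; exists l; apply: IH Gji.
Qed.

Lemma hmem_heql x x' y : heq x x' -> hmem x y -> hmem x' y.
Proof.
by case: y => //= G /heq_sym xx' [j xj]; exists j; apply: heq_trans xj.
Qed.

Lemma heq_ext x y : heq x y <-> forall z, hmem z x <-> hmem z y.
Proof.
split.
  case: x y => [|F] [|G] //= [FG GF] z; split=> -[i zi].
    by have [j Fij] := FG i; exists j; apply: heq_trans Fij.
  by have [j Fji] := GF i; exists j; apply: heq_trans (heq_sym Fji).
case: x y => [|F] [|G] //= xy.
- by apply/(xy (G 0)); exists 0; apply: heq_refl.
- by apply/(xy (F 0)); exists 0; apply: heq_refl.
split=> i; first by apply/(xy (F i)); exists i; apply: heq_refl.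
have [|j Gij] := (xy (G i)).2; first by exists i; apply: heq_refl.
by exists j; apply: heq_sym.
Qed.

Lemma hmem_heqr x y y' : heq y y' -> hmem x y -> hmem x y'.
Proof. by move/heq_ext=> yy' /yy'. Qed.

(** Well-foundedness of HC: an [x] in [x] equals one of its own members [F j],
    and then [F j] is in [F j]. *)
Lemma hmem_irr x : ~ hmem x x.
Proof.
elim: x => [[]|F IH [j Fj]]; apply: (IH j).
by apply: hmem_heqr Fj _; exists j; apply: heq_refl.
Qed.

Lemma heq_congr x x' y y' : heq x x' -> heq y y' -> heq x y <-> heq x' y'.
Proof.
move=> xx' yy'; split=> h.
  by apply: heq_trans yy'; apply: heq_trans (heq_sym xx') h.
by apply: heq_trans (heq_sym yy'); apply: heq_trans xx' h.
Qed.

Lemma hmem_succ z x : hmem z (hsucc x) <-> hmem z x \/ heq z x.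
Proof.
case: x => [|F] /=; first by split=> [[]|[//|zx]]; [right|exists 0].
split=> [[[|j] zj]|[[j zj]|zx]]; [by right|by left; exists j| |].
  by exists j.+1.
by exists 0.
Qed.

Lemma hmem_nat z n : hmem z (hnat n) <-> exists2 i, (i < n)%N & heq z (hnat i).
Proof.
elim: n => [|n IH]; first by split=> // -[].
split=> [/hmem_succ[/IH[i lt_in zi]|zn]|[i]].
- by exists i; first exact: ltnW.
- by exists n.
rewrite ltnS leq_eqVlt => /predU1P[-> zn|lt_in zi]; apply/hmem_succ.
  by right.
by left; apply/IH; exists i.
Qed.

Lemma hnat_inj i j : heq (hnat i) (hnat j) -> i = j.
Proof.
wlog lt_ij : i j / (i < j)%N.
  move=> W; have [lt_ij|lt_ji|//] := ltngtP i j; first exact: W.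
  by move/heq_sym/W => ->.
move=> eq_ij; case: (@hmem_irr (hnat i)).
apply: hmem_heqr (heq_sym eq_ij) _; apply/hmem_nat.
by exists i; last exact: heq_refl.
Qed.

Lemma hmem_image z F D :
  hmem z (himage F D) <-> exists2 n, D n & heq z (F n).
Proof.
rewrite /himage; case: asboolP => [D0|D0]; last first.
  by split=> // -[n Dn _]; case: D0; exists n.
split=> /= [[j]|[n Dn zn]]; last by exists n; rewrite mem_set.
case: ifP => [/set_mem Dj|_] zj; first by exists j.
by exists (get D); first exact: getPex.
Qed.

Lemma hmem_real z X : hmem z (hreal X) <-> exists2 n, X n & heq z (hnat n).
Proof. exact: hmem_image. Qed.

Lemma hmem_hnat_real n X : hmem (hnat n) (hreal X) <-> X n.
Proof.
rewrite hmem_real; split=> [[i Xi /hnat_inj->//]|Xn].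
by exists n; last exact: heq_refl.
Qed.

Lemma hreal_inj X Y : heq (hreal X) (hreal Y) -> X = Y.
Proof.
move/heq_ext=> XY; apply/seteqP.
by split=> n /hmem_hnat_real/XY/hmem_hnat_real.
Qed.

Lemma hmem_upair z x y : hmem z (hupair x y) <-> heq z x \/ heq z y.
Proof.
split=> [[[|j] zj]|[zx|zy]].
- by left.
- by right.
- by exists 0.
- by exists 1.
Qed.

Lemma hupair_congr x x' y y' :
  heq x x' -> heq y y' -> heq (hupair x y) (hupair x' y').
Proof.
move=> xx' yy'; apply/heq_ext => z; rewrite !hmem_upair.
have:= heq_congr (heq_refl z) xx'; have:= heq_congr (heq_refl z) yy'; tauto.
Qed.

Lemma hupair_inj x y x' y' : heq (hupair x y) (hupair x' y') ->
  (heq x x' /\ heq y y') \/ (heq x y' /\ heq y x').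
Proof.
move=> /heq_ext E.
have /hmem_upair := (E x).1 ((hmem_upair _ _ _).2 (or_introl (heq_refl x))).
have /hmem_upair := (E y).1 ((hmem_upair _ _ _).2 (or_intror (heq_refl y))).
have /hmem_upair := (E x').2 ((hmem_upair _ _ _).2 (or_introl (heq_refl x'))).
have /hmem_upair := (E y').2 ((hmem_upair _ _ _).2 (or_intror (heq_refl y'))).
have:= @heq_sym x' x; have:= @heq_sym x' y.
have:= @heq_sym y' x; have:= @heq_sym y' y; tauto.
Qed.

Lemma hpair_congr x x' y y' :
  heq x x' -> heq y y' -> heq (hpair x y) (hpair x' y').
Proof. by move=> xx' yy'; do !apply: hupair_congr. Qed.

Lemma hpair_inj x y x' y' :
  heq (hpair x y) (hpair x' y') -> heq x x' /\ heq y y'.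
Proof.
case/hupair_inj => -[/hupair_inj E1 /hupair_inj E2].
  have xx' : heq x x' by tauto.
  split=> //; case: E2 => -[] // xy' yx'.
  by apply: heq_trans yx' _; apply: heq_trans (heq_sym xx') _.
have xx' : heq x x' by tauto.
have xy' : heq x y' by tauto.
have yx' : heq y x' by tauto.
by split=> //; apply: heq_trans yx' _; apply: heq_trans (heq_sym xx') _.
Qed.

Lemma hmem_seq z s : hmem z (hseq s) <->
  exists2 i, (i < size s)%N & heq z (hpair (hnat i) (hreal (nth set0 s i))).
Proof. exact: hmem_image. Qed.

(** Every countable family has a set of its values; the empty family is apart
    since [hrange] only produces nonempty sets. *)
Lemma hset_exists (I : countType) (G : I -> HC) (D : set I) :
  exists y, forall z, hmem z y <-> exists2 i, D i & heq z (G i).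
Proof.
have [[i0 Di0]|D0] := pselect (D !=set0); last first.
  by exists hempty => z; split=> // -[i Di _]; case: D0; exists i.
pose pick c := if unpickle c is Some i then if i \in D then i else i0 else i0.
have Dpick c : D (pick c).
  by rewrite /pick; case: unpickle => // i; case: ifP => // /set_mem.
exists (hrange (fun c => G (pick c))) => z; split=> /= [[c zc]|[i Di zi]].
  by exists (pick c).
by exists (pickle i); rewrite /pick pickleK mem_set.
Qed.

(** * Predicates expressed by a formula *)

(** Semantic counterpart of having a formula with free variables below [n]: it
    makes definability a matter of closure properties, with quantifiers of the
    ambient logic in place of de Bruijn binders. *)
Definition expressible n (P : (nat -> HC) -> Prop) : Prop :=
  exists2 p, free_below n p & forall v, sat v p <-> P v.

Lemma expr_ext n P Q : (forall v, P v <-> Q v) ->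
  expressible n P -> expressible n Q.
Proof. by move=> PQ [p pn sp]; exists p => // v; rewrite sp. Qed.

Lemma expr_mem n i j : (i < n)%N -> (j < n)%N ->
  expressible n (fun v => hmem (v i) (v j)).
Proof. by move=> ltin ltjn; exists (FMem i j) => //=; rewrite ltin. Qed.

Lemma expr_eq n i j : (i < n)%N -> (j < n)%N ->
  expressible n (fun v => heq (v i) (v j)).
Proof. by move=> ltin ltjn; exists (FEq i j) => //=; rewrite ltin. Qed.

Lemma expr_not n P : expressible n P -> expressible n (fun v => ~ P v).
Proof. by move=> [p pn sp]; exists (FNot p) => // v /=; rewrite sp. Qed.

Lemma expr_and n P Q : expressible n P -> expressible n Q ->
  expressible n (fun v => P v /\ Q v).
Proof.
move=> [p pn sp] [q qn sq]; exists (FAnd p q) => /= [|v]; first by rewrite pn.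
by rewrite sp sq.
Qed.

Lemma expr_or n P Q : expressible n P -> expressible n Q ->
  expressible n (fun v => P v \/ Q v).
Proof.
move=> eP eQ; apply: expr_ext (expr_not (expr_and (expr_not eP) (expr_not eQ))).
by move=> v; have := EM (P v); have := EM (Q v); tauto.
Qed.

Lemma expr_imp n P Q : expressible n P -> expressible n Q ->
  expressible n (fun v => P v -> Q v).
Proof.
move=> eP eQ; apply: expr_ext (expr_or (expr_not eP) eQ).
by move=> v; have := EM (P v); tauto.
Qed.

Lemma expr_iff n P Q : expressible n P -> expressible n Q ->
  expressible n (fun v => P v <-> Q v).
Proof. by move=> eP eQ; apply: expr_and; apply: expr_imp. Qed.

(** The predicate is split into a bound variable and a valuation so that
    unification recovers it from a goal of the form [fun v => exists x, _];
    the remaining goal then reads the bound variable at index 0. *)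
Lemma expr_ex n (P : HC -> (nat -> HC) -> Prop) :
  expressible n.+1 (fun v => P (v 0) (fun i => v i.+1)) ->
  expressible n (fun v => exists x, P x v).
Proof.
move=> [p pn sp]; exists (FEx p) => // v /=.
by split=> -[x Px]; exists x; apply/(sp (scons x v)).
Qed.

Lemma expr_all n (P : HC -> (nat -> HC) -> Prop) :
  expressible n.+1 (fun v => P (v 0) (fun i => v i.+1)) ->
  expressible n (fun v => forall x, P x v).
Proof.
move=> eP.
apply: expr_ext (expr_not (@expr_ex _ (fun x v => ~ P x v) _)) => [v|].
  split=> [nP x|Pv [x nPx]]; last exact: nPx (Pv x).
  by apply: contrapT => nPx; apply: nP; exists x.
exact: expr_not.
Qed.

Ltac express1 := cbv beta; first
  [ apply: expr_ex | apply: expr_and | apply: expr_or | apply: expr_iff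
  | apply: expr_mem | apply: expr_eq | apply: expr_not
  | apply: expr_imp | apply: expr_all | done ].

Lemma expr_upair n i j k : (i < n)%N -> (j < n)%N -> (k < n)%N ->
  expressible n (fun v => heq (v i) (hupair (v j) (v k))).
Proof.
move=> ltin ltjn ltkn; apply: (@expr_ext _ (fun v => forall z,
  hmem z (v i) <-> heq z (v j) \/ heq z (v k))) => [v|].
  by rewrite heq_ext; split=> E z; rewrite E hmem_upair.
by do !express1.
Qed.

Lemma expr_pair n i j k : (i < n)%N -> (j < n)%N -> (k < n)%N ->
  expressible n (fun v => heq (v i) (hpair (v j) (v k))).
Proof.
move=> ltin ltjn ltkn; apply: (@expr_ext _ (fun v => forall z,
  hmem z (v i) <->
  heq z (hupair (v j) (v j)) \/ heq z (hupair (v j) (v k)))) => [v|].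
  by rewrite heq_ext; split=> E z; rewrite E hmem_upair.
by do !first [apply: expr_upair | express1].
Qed.

Lemma expr_pair_mem n i j k : (i < n)%N -> (j < n)%N -> (k < n)%N ->
  expressible n (fun v => hmem (hpair (v i) (v j)) (v k)).
Proof.
move=> ltin ltjn ltkn; apply: (@expr_ext _ (fun v => exists z,
  heq z (hpair (v i) (v j)) /\ hmem z (v k))) => [v|].
  split=> [[z [zp]]|pk]; first exact: hmem_heql.
  by exists (hpair (v i) (v j)); split=> //; apply: heq_refl.
by do !first [apply: expr_pair | express1].
Qed.

Lemma expr_pair_pair_mem n i j k l m :
  (i < n)%N -> (j < n)%N -> (k < n)%N -> (l < n)%N -> (m < n)%N ->
  expressible n (fun v => hmem (hpair (hpair (v i) (v j)) (hpair (v k) (v l)))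
    (v m)).
Proof.
move=> ltin ltjn ltkn ltln ltmn; apply: (@expr_ext _ (fun v => exists x y,
  heq x (hpair (v i) (v j)) /\ heq y (hpair (v k) (v l)) /\
  hmem (hpair x y) (v m))) => [v|].
  split=> [[x [y [xp [yp]]]]|pm]; first exact/hmem_heql/hpair_congr.
  by do 2!eexists; split; [|split; [|exact: pm]]; apply: heq_refl.
by do !first [apply: expr_pair_mem | apply: expr_pair | express1].
Qed.

Ltac express := do !first [apply: expr_pair_mem | apply: expr_pair_pair_mem
  | apply: expr_pair | express1].

Lemma expressible_definable (P : HC -> HC -> Prop) a (A : set HC) :
  expressible 2 (fun v => P (v 0) (v 1)) -> (forall x, A x <-> P x a) ->
  definable A.
Proof.
by move=> [p p2 sp] AP; exists p, a; split=> // x; rewrite AP sp.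
Qed.

(** * Definable classes of sequences of reals *)

Definition is_omega w := forall z, hmem z w <-> exists n, heq z (hnat n).

(** First-order description, relative to a copy [w] of omega, of the code of
    an injective sequence of reals of length [k].  The last clause says at once
    that [x] is a function and that it is injective. *)
Definition codes_inj_seq w k x : Prop :=
  hmem k w /\
  (forall z, hmem z x -> exists i r,
     heq z (hpair i r) /\ forall u, hmem u r -> hmem u w) /\
  (forall i, hmem i k <-> exists r, hmem (hpair i r) x) /\
  (forall i r j s, hmem (hpair i r) x -> hmem (hpair j s) x ->
     (heq i j <-> heq r s)).

Lemma hmem_pair_seq i r s : hmem (hpair i r) (hseq s) <->
  exists2 n, (n < size s)%N & heq i (hnat n) /\ heq r (hreal (nth set0 s n)).
Proof.
rewrite hmem_seq; split=> -[n lt_n]; first by move/hpair_inj; exists n.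
by case=> *; exists n => //; apply: hpair_congr.
Qed.

Lemma hseq_codes w x s : is_omega w -> uniq s -> heq x (hseq s) ->
  codes_inj_seq w (hnat (size s)) x.
Proof.
move=> wP us /heq_ext xE; rewrite /codes_inj_seq.
setoid_rewrite xE.
split; [|split=> [z /hmem_seq[i lt_i zi]|]; [|split=> [i|i r j r']]].
- by apply/wP; exists (size s); apply: heq_refl.
- exists (hnat i), (hreal (nth set0 s i)); split=> // u /hmem_real[n _ un].
  by apply/wP; exists n.
- rewrite hmem_nat.
  split=> [[n lt_n iE]|[r /hmem_pair_seq[n lt_n []]]]; last by exists n.
  exists (hreal (nth set0 s n)); apply/hmem_pair_seq.
  by exists n; last by split; [|apply: heq_refl].
move=> /hmem_pair_seq[n lt_n [iE rE]] /hmem_pair_seq[m lt_m [jE r'E]].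
rewrite (heq_congr iE jE) (heq_congr rE r'E); split.
  by move/hnat_inj->; apply: heq_refl.
by move/hreal_inj/eqP; rewrite nth_uniq// => /eqP->; apply: heq_refl.
Qed.

(** Conversely a set with this description is the code of an actual sequence:
    the i-th real consists of the [m] whose numeral is in the value at [i]. *)
Lemma codes_hseq w k x : is_omega w -> codes_inj_seq w k x ->
  exists s, [/\ uniq s, heq k (hnat (size s)) & heq x (hseq s)].
Proof.
move=> wP [/wP[n kn] [xP [dom inj]]].
have memk i : (i < n)%N -> hmem (hnat i) k.
  move=> lt_i; apply: hmem_heqr (heq_sym kn) _; apply/hmem_nat.
  by exists i; last exact: heq_refl.
have /choice[X Xx] i : exists X, (i < n)%N -> hmem (hpair (hnat i) (hreal X)) x.
  have [lt_i|] := boolP (i < n)%N; last by exists set0.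
  have [r rx] := (dom _).1 (memk i lt_i).
  exists [set m | hmem (hnat m) r] => _; apply: hmem_heql (rx).
  have [i' [r' [/hpair_inj[_ rr'] r'w]]] := xP _ rx.
  apply: hpair_congr; [exact: heq_refl | apply/heq_ext => z].
  rewrite hmem_real; split=> [zr|[m /= mr zm]]; last first.
    exact: hmem_heql (heq_sym zm) mr.
  have /wP[m zm] := r'w z (hmem_heqr rr' zr).
  by exists m => //=; apply: hmem_heql zr.
exists (mkseq X n); split; rewrite ?size_mkseq//.
  apply/mkseq_uniqP => i j; rewrite !inE => lt_i lt_j eqX.
  apply: hnat_inj; apply/(inj _ _ _ _ (Xx i lt_i) (Xx j lt_j)).
  by rewrite eqX; apply: heq_refl.
apply/heq_ext => z; rewrite hmem_seq size_mkseq.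
split=> [zx|[i lt_i]]; last first.
  by rewrite nth_mkseq// => /heq_sym/hmem_heql; apply; apply: Xx.
have [i [r [zE _]]] := xP z zx.
have irx : hmem (hpair i r) x by apply: hmem_heql zx.
have /(hmem_heqr kn)/hmem_nat[m lt_m im] : hmem i k by apply/dom; exists r.
exists m; rewrite ?nth_mkseq//; apply: heq_trans zE _; apply: hpair_congr => //.
exact/(inj _ _ _ _ irx (Xx m lt_m)).
Qed.

(** A quadruple [((k, m), (n, j))] of [B] says that, for a sequence of length
    [k] to have [m] in its trace, its n-th entry must contain [j].  With a
    suitable [B] every intersection of a matrix is a trace. *)
Definition trace (B : set (nat * nat * (nat * nat))) (s : seq (set nat)) :
    set nat :=
  [set m | forall n j, (n < size s)%N -> B ((size s, m), (n, j)) ->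
     nth set0 s n j].

(** The first-order form of [m \in trace B s], in terms of sets [b], [k], [x],
    [m] coding [B], [size s], [s], [m]. *)
Definition htrace b k x m : Prop := forall n r j,
  hmem (hpair n r) x -> hmem (hpair (hpair k m) (hpair n j)) b -> hmem j r.

Definition codes_quads b (B : set (nat * nat * (nat * nat))) :=
  forall z, hmem z b <-> exists2 q, B q &
    heq z (hpair (hpair (hnat q.1.1) (hnat q.1.2))
                 (hpair (hnat q.2.1) (hnat q.2.2))).

Lemma htraceP b B s k x z m : codes_quads b B ->
  heq k (hnat (size s)) -> heq x (hseq s) -> heq z (hnat m) ->
  htrace b k x z <-> trace B s m.
Proof.
move=> bB kE xE zE; split=> [tr n j lt_n Bnj|tr n r j].
  apply/hmem_hnat_real; apply: (tr (hnat n)).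
    apply: hmem_heqr (heq_sym xE) _; apply/hmem_pair_seq; exists n => //.
    by split; apply: heq_refl.
  apply/bB; eexists; first exact: Bnj.
  by do !apply: hpair_congr => //; apply: heq_refl.
move=> /(hmem_heqr xE)/hmem_pair_seq[i lt_i [ni ri]].
move=> /bB[[[k' m'] [n' j']] Bq] /=.
move=> /hpair_inj[/hpair_inj[kk' zm'] /hpair_inj[nn' jj']].
have ek : size s = k' by apply/hnat_inj/(heq_congr kE (heq_refl _)).
have em : m = m' by apply/hnat_inj/(heq_congr zE (heq_refl _)).
have en : i = n' by apply/hnat_inj/(heq_congr ni (heq_refl _)).
apply: hmem_heqr (heq_sym ri) _; apply/hmem_real; exists j' => //.
by apply: tr => //; rewrite ek em en.
Qed.

(** [E] is the set of lengths at which a condition is imposed. *)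
Definition trace_class (Psi : set nat -> Prop) (E : set nat) B :
    set (seq (set nat)) :=
  [set s | uniq s /\ (E (size s) -> Psi (trace B s))].

(** Here [psi w d] is the first-order form of [Psi]: [w] is a copy of omega and
    [d] the predicate of membership in the set to be tested.  The parameter is
    the triple of omega, the set of lengths and the set of quadruples; the
    formula first recovers the three components from it. *)
Lemma trace_class_definable (Psi : set nat -> Prop)
    (psi : HC -> (HC -> Prop) -> Prop) (E : set nat) B :
  (forall n w b k x, (w < n)%N -> (b < n)%N -> (k < n)%N -> (x < n)%N ->
     expressible n (fun v => psi (v w) (htrace (v b) (v k) (v x)))) ->
  (forall w d D, is_omega w ->
     (forall z m, heq z (hnat m) -> d z <-> D m) -> psi w d <-> Psi D) ->
  definable_seqs (trace_class Psi E B).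
Proof.
move=> psi_expr psiP.
have [w wP'] := @hset_exists nat hnat setT.
have wP : is_omega w by move=> z; rewrite wP'; split=> -[n] //; exists n.
have [b bP] := @hset_exists _ (fun q => hpair (hpair (hnat q.1.1) (hnat q.1.2))
                 (hpair (hnat q.2.1) (hnat q.2.2))) B.
apply: (@expressible_definable (fun x a => exists w c e b k,
  heq a (hpair w c) /\ heq c (hpair e b) /\
  codes_inj_seq w k x /\ (hmem k e -> psi w (htrace b k x)))
  (hpair w (hpair (hreal E) b))) => [|x].
  by do !first [apply: psi_expr | express].
split=> [[s [us Es] xE]|
  [w' [c [e [b' [k [/hpair_inj[ww' cE] [cE' [xs psik]]]]]]]]].
  exists w, (hpair (hreal E) b), (hreal E), b, (hnat (size s)).
  split; [exact: heq_refl | split; [exact: heq_refl | split]].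
    exact: hseq_codes.
  move=> /hmem_hnat_real/Es; apply: (psiP _ _ _ _ _).2 => // z m zm.
  by apply: htraceP bP _ xE zm; apply: heq_refl.
have [ee' bb'] : heq (hreal E) e /\ heq b b'.
  by apply: hpair_inj; apply: heq_trans cE cE'.
have wP2 : is_omega w'.
  by move=> z; rewrite -wP; apply: iff_sym; move: z; apply/heq_ext.
have bP2 : codes_quads b' B.
  by move=> z; rewrite -bP; apply: iff_sym; move: z; apply/heq_ext.
have [s [us kE xE]] := codes_hseq wP2 xs.
exists s => //; split=> // Es; apply/(psiP w' (htrace b' k x)) => // [z m zm|].
  exact: htraceP bP2 kE xE zm.
apply: psik; apply: hmem_heql (heq_sym kE) _; apply: hmem_heqr ee' _.
exact/hmem_hnat_real.
Qed.

Lemma nonempty_trace_definable (E : set nat) B :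
  definable_seqs (trace_class (fun D => D !=set0) E B).
Proof.
apply: (@trace_class_definable _ (fun w d => exists m, hmem m w /\ d m)).
  by move=> n w b k x *; rewrite /htrace; express.
move=> w d D wP dD; split=> [[z [/wP[m zm] dz]]|[m Dm]].
  by exists m; apply/(dD z).
exists (hnat m); split; first by apply/wP; exists m; apply: heq_refl.
by apply/(dD _ m); first exact: heq_refl.
Qed.

(** A set of natural numbers is finite iff it is bounded, and the order of
    omega is membership. *)
Lemma finite_trace_definable (E : set nat) B :
  definable_seqs (trace_class finite_set E B).
Proof.
apply: (@trace_class_definable _ (fun w d => exists b, hmem b w /\
  forall m, hmem m w -> d m -> hmem m b)).
  by move=> n w b k x *; rewrite /htrace; express.
move=> w d D wP dD; split=> [[z [/wP[b zb] dz]]|].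
  apply: (@sub_finite_set _ _ `I_b); last exact: finite_II.
  move=> m Dm /=; have zm := heq_refl (hnat m).
  have /(hmem_heqr zb)/hmem_nat[i lt_ib /hnat_inj->//] : hmem (hnat m) z.
  by apply: dz; [apply/wP; exists m | apply/(dD _ m)].
move=> /finite_seqP[s Ds]; exists (hnat (\max_(i <- s) i).+1); split.
  by apply/wP; eexists; apply: heq_refl.
move=> m /wP[i mi] /(dD _ _ mi) Di; apply/hmem_nat; exists i => //.
by rewrite ltnS; apply: leq_bigmax_seq => //; rewrite Ds in Di.
Qed.

(** * Clubs and stationary sets *)

Section Stationary.
Context {d : Order.disp_t} (K : orderType d).
Context (hK : regular_uncountable_cardinal K).
Implicit Types C S X : set K.

Lemma unbounded_no_small X (T : Type) (Y : set T) :
  unbounded X -> X #<= Y -> [set: K] #<= Y.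
Proof. by case: hK => _ reg _ /reg /card_le_trans; apply. Qed.

Lemma exists_gt (x : K) : exists y, (x < y)%O.
Proof.
case: hK => _ reg uncK; apply: contrapT => no_gt; apply: uncK.
apply: (@sub_countable _ _ _ [set x]); last exact: countable1.
apply: reg => y; exists x => //; rewrite leNgt; apply/negP => lt_xy.
by apply: no_gt; exists y.
Qed.

Lemma not_unbounded X : ~ unbounded X -> exists x, forall y, X y -> (y < x)%O.
Proof.
move=> /existsNP[x nX]; exists x => y Xy; rewrite ltNge; apply/negP => le_xy.
by apply: nX; exists y.
Qed.

Lemma bounded_image (h : K -> K) (x : K) :
  exists y, forall z, (z < x)%O -> (h z < y)%O.
Proof.
have [|y hy] := @not_unbounded (h @` [set z | (z < x)%O]); last first.
  by exists y => z lt_zx; apply: hy; exists z.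
case: hK => -[_ init] _ _ ub; apply: (init x).
exact: unbounded_no_small ub (card_image_le _ _).
Qed.

Lemma bounded_seq (u : nat -> K) : exists x, forall n, (u n < x)%O.
Proof.
have [|x ux] := @not_unbounded (range u); last first.
  by exists x => n; apply: ux; exists n.
case: hK => _ _ uncK ub; apply: uncK.
exact: unbounded_no_small ub (card_image_le _ _).
Qed.

Lemma exists_least (P : set K) : P !=set0 ->
  exists2 x, P x & forall y, P y -> (x <= y)%O.
Proof.
case: hK => -[wf _] _ _ [x Px]; elim: (wf x) Px => {}x _ IH Px.
have [[y Py lt_yx]|min] := pselect (exists2 y, P y & (y < x)%O).
  exact: IH lt_yx Py.
exists x => // y Py; rewrite leNgt; apply/negP => lt_yx.
by apply: min; exists y.
Qed.

Lemma exists_sup (u : nat -> K) : (forall n, u n < u n.+1)%O ->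
  exists2 x, (forall n, u n < x)%O &
    forall y, (y < x)%O -> exists n, (y < u n)%O.
Proof.
move=> incr; have [x ux min] := exists_least (bounded_seq u); exists x => // y.
rewrite ltNge => /negP lt_yx; apply: contrapT => no_n; apply: lt_yx.
apply: min => n; apply: lt_le_trans (incr n) _.
by rewrite leNgt; apply/negP => lt_yu; apply: no_n; exists n.+1.
Qed.

(** The diagonal intersection of the [F z], cut above [x0]; the cut makes tails
    and, in [stationaryI], intersections of two clubs special cases. *)
Definition diagonal (F : K -> set K) (x0 : K) : set K :=
  [set x | (x0 < x)%O /\ forall z, (z < x)%O -> F z x].

(** Unboundedness: by regularity, above any [y] there is [y'] such that all
    [F z] with [z < y] have points between [y] and [y'].  Iterating omega
    times, the supremum is a limit of each [F z] with [z] below it. *)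
Lemma club_diagonal (F : K -> set K) (x0 : K) :
  (forall z, club (F z)) -> club (diagonal F x0).
Proof.
move=> clF; split=> [x [y lt_yx] limx|x].
  split; first by have [z [[x0z _] _ ?]] := limx y lt_yx; apply: lt_trans x0z _.
  move=> z lt_zx; apply: (clF z).1 => [|y' lt_y'x]; first by exists y.
  have [|c [[_ Fc] lt_c ltcx]] := limx (Order.max y' z).
    by rewrite gt_max lt_y'x.
  by move: lt_c; rewrite gt_max => /andP[? ?]; exists c; split=> //; apply: Fc.
have next y : exists y', (y < y')%O /\ forall z, (z < y)%O ->
    exists c, [/\ F z c, (y < c)%O & (c < y')%O].
  have [y1 lt_yy1] := exists_gt y.
  have /choice[h hP] z : exists c, F z c /\ (y1 <= c)%O.
    by have [c Fc le_c] := (clF z).2 y1; exists c.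
  have [y2 hy2] := bounded_image h y.
  exists (Order.max y1 y2); split; first by rewrite lt_max lt_yy1.
  move=> z lt_zy; have [Fz le_h] := hP z; exists (h z); split=> //.
    exact: lt_le_trans le_h.
  by rewrite lt_max hy2 ?orbT.
have [g gP] := choice next.
pose u n := iter n g (Order.max x0 x).
have incr n : (u n < u n.+1)%O by have [] := gP (u n).
have [s us sup] := exists_sup incr; exists s; last first.
  by apply: ltW; have := us 0; rewrite gt_max => /andP[].
split; first by have := us 0; rewrite gt_max => /andP[].
move=> z lt_zs; apply: (clF z).1 => [|y lt_ys]; first by exists z.
have [|n] := sup (Order.max y z); first by rewrite gt_max lt_ys.
rewrite gt_max => /andP[lt_y lt_z].
have [c [Fc lt_c lt_c']] := (gP (u n)).2 z lt_z.
exists c; split=> //; first exact: lt_trans lt_c.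
exact: lt_trans lt_c' (us n.+1).
Qed.

Lemma clubT : club [set: K].
Proof. by split=> // x; exists x. Qed.

Lemma stationary_gt S x : stationary S -> exists2 y, S y & (x < y)%O.
Proof.
move=> stS; have [y [Sy [lt_xy _]]] := stS _ (@club_diagonal _ x (fun=> clubT)).
by exists y.
Qed.

Lemma inhabitedK : inhabited K.
Proof.
case: hK => _ _ uncK; apply: contrapT => K0; apply: uncK.
suff -> : [set: K] = set0 by exact: countable0.
by apply/seteqP; split=> // x _; case: K0; apply: inhabits.
Qed.

Lemma stationaryI S C : stationary S -> club C -> stationary (S `&` C).
Proof.
move=> stS clC C' clC'.
have [x0] := inhabitedK; have [x1 lt_x01] := exists_gt x0.
(* Above [x1], membership in the diagonal intersection of this family includes
   the instances at [x0] and at [x1], that is, membership in [C] and [C']. *)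
pose F z := if z == x0 then C else C'.
have [|x [Sx [lt_x1 Fx]]] := stS _ (@club_diagonal F x1 _).
  by move=> z; rewrite /F; case: eqP.
have := Fx x0 (lt_trans lt_x01 lt_x1); have := Fx x1 lt_x1.
by rewrite /F eqxx gt_eqF// => C'x Cx; exists x.
Qed.

(** If no fibre of [f] is stationary, choose for each [z] a club [F z] missing
    the fibre through [z].  For [x < y] in the diagonal intersection, [y] is
    in [F x] and so [f y] differs from [f x]. *)
Lemma constant_or_injective (T : Type) (f : K -> T) :
  (exists2 S, stationary S & forall x y, S x -> S y -> f x = f y) \/
  (exists2 C, club C & forall x y, C x -> C y -> f x = f y -> x = y).
Proof.
have [[x st]|nst] := pselect (exists x, stationary [set y | f y = f x]).
  by left; exists [set y | f y = f x] => // y z -> ->.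
right; have /choice[F FP] z : exists C, club C /\ forall x, C x -> f x <> f z.
  have /existsNP[C /not_implyP[clC dis]] : ~ stationary [set y | f y = f z].
    by move=> st; apply: nst; exists z.
  by exists C; split=> // x Cx fxz; apply: dis; exists x.
have [x0] := inhabitedK; exists (diagonal F x0).
  by apply: club_diagonal => z; have [] := FP z.
move=> x y [_ Fx] [_ Fy] fxy; have [lt_xy|lt_yx|//] := ltgtP x y.
  by case: (FP x) => _ /(_ y (Fy x lt_xy)); case.
by case: (FP y) => _ /(_ x (Fx y lt_yx)).
Qed.

Lemma seq_bound (l : seq K) : exists y, forall x, x \in l -> (x <= y)%O.
Proof.
elim: l => [|x l [y ly]]; first by have [x] := inhabitedK; exists x.
exists (Order.max x y) => z; rewrite inE le_max => /predU1P[->|/ly ->].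
  by rewrite lexx.
by rewrite orbT.
Qed.

(** * The dichotomy *)

(** Stationary sets are unbounded, hence have a point above any given finite
    sequence: entries can be added one at a time. *)
Lemma extend_inj_seq k (S : 'I_k -> set K) x0 l :
  (forall i, stationary (S i)) -> (size l <= k)%N -> uniq l ->
  (forall i : 'I_k, (i < size l)%N -> S i (nth x0 l i)) ->
  exists l', [/\ size (l ++ l') = k, uniq (l ++ l') &
    forall i : 'I_k, S i (nth x0 (l ++ l') i)].
Proof.
move=> stS; have [m] := ubnP (k - size l).
elim: m l => // m IH l lt_m le_lk ul Sl.
have [eq_lk|lt_lk] := eqVneq (size l) k.
  exists [::]; rewrite cats0; split=> // i; apply: Sl.
  by rewrite eq_lk.
have {}lt_lk : (size l < k)%N by rewrite ltn_neqAle lt_lk.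
have [y ly] := seq_bound l.
have [z Sz lt_yz] := stationary_gt y (stS (Ordinal lt_lk)).
have zl : z \notin l by apply: contraL lt_yz => /ly; rewrite leNgt.
have [|||i|l' [sl' ul' Sl']] := IH (rcons l z).
- by rewrite size_rcons -ltnS (leq_trans _ lt_m)// ltnS ltn_sub2l.
- by rewrite size_rcons.
- by rewrite rcons_uniq zl.
- rewrite size_rcons ltnS leq_eqVlt nth_rcons => /predU1P[eq_i|lt_i].
    rewrite eq_i ltnn eqxx; suff -> : i = Ordinal lt_lk by [].
    exact: val_inj.
  by rewrite lt_i; apply: Sl.
by exists (z :: l'); rewrite -cat_rcons.
Qed.

Section Matrix.
Variable a : K -> nat -> set nat.

Definition row_code (x : K) : set nat :=
  [set j | exists2 q : nat * nat, a x q.1 q.2 & j = pickle q].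

Lemma row_code_pickle x c m : row_code x (pickle (c, m)) <-> a x c m.
Proof.
split=> [[q aq /(pcan_inj pickleK) qE]|axcm]; first by rewrite -qE in aq.
by exists (c, m).
Qed.

Lemma row_code_inj x y : row_code x = row_code y -> a x = a y.
Proof.
move=> xy; apply/funext => c; apply/seteqP.
by split=> m /row_code_pickle; rewrite (xy, =^~ xy) => /row_code_pickle.
Qed.

(** The length of the sequences on which [t] is tested.  It determines [t] and
    is at least [size t], since the code of a sequence bounds its length; the
    successor makes it positive, the empty sequence being out of reach
    of HP. *)
Definition test_length (t : seq nat) : nat := (CodeSeq.code t).+1.

Lemma size_test_length t : (size t <= test_length t)%N.
Proof.
rewrite /test_length; apply: leqW; elim: t => //= n t IH.
apply: leq_trans (leq_pmull _ _); last by rewrite expn_gt0.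
by rewrite ltnS -addnn (leq_trans IH) ?leq_addr.
Qed.

(** The quadruples for which the trace of a sequence of rows of length
    [test_length t] is the intersection for [t]. *)
Definition column_test : set (nat * nat * (nat * nat)) :=
  [set q | let t := CodeSeq.decode q.1.1.-1 in
    (q.2.1 < size t)%N /\ q.2.2 = pickle (nth 0 t q.2.1, q.1.2)].

(** [matrix_cap] for a sequence of indices of any length, of which only the
    first [size t] entries count. *)
Definition seq_cap x0 (t : seq nat) (l : seq K) : set nat :=
  [set m | forall n, (n < size t)%N -> a (nth x0 l n) (nth 0 t n) m].

Lemma matrix_capE x0 t (al : (size t).-tuple K) :
  matrix_cap a al = seq_cap x0 t al.
Proof.
apply/seteqP; split=> [m capm n lt_n|m capm n _].
  by have := capm (Ordinal lt_n) I; rewrite !(tnth_nth x0) !(tnth_nth 0).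
by rewrite (tnth_nth x0) (tnth_nth 0); apply: capm.
Qed.

Lemma trace_row_code x0 t l : size l = test_length t ->
  trace column_test (map row_code l) = seq_cap x0 t l.
Proof.
move=> sl; have le_tl : (size t <= size l)%N by rewrite sl size_test_length.
rewrite /trace /column_test size_map sl /= CodeSeq.codeK.
apply/seteqP; split=> m /= H => [n lt_n|n j lt_n [lt_nt ->]].
  apply/row_code_pickle; rewrite -(nth_map _ set0) ?(leq_trans lt_n)//.
  by apply: H; rewrite // -sl (leq_trans lt_n).
by rewrite (nth_map x0) ?sl//; apply/row_code_pickle/H.
Qed.

Lemma seq_cap_cat x0 t l l' : size l = size t ->
  seq_cap x0 t (l ++ l') = seq_cap x0 t l.
Proof.
move=> sl; apply/seteqP.
by split=> m H n lt_n; have := H n lt_n; rewrite nth_cat sl lt_n.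
Qed.

(** The two principles are the cases of nonempty and of finite intersections;
    definability of the classes of sequences built from [Psi] is all that HP
    asks of it.  The set A given to HP is the class of injective sequences
    whose length is not [test_length t] for any [t] in [T], or is so and for
    which the intersection for this [t] satisfies [Psi]. *)
Lemma homogeneity_dichotomy (Psi : set nat -> Prop) (T : set (seq nat)) :
  (forall E B, definable_seqs (trace_class Psi E B)) -> HP K ->
  (exists2 S : set K, stationary S &
     forall t, T t -> forall al : (size t).-tuple K,
       inj_tuples S al -> Psi (matrix_cap a al)) \/
  (exists2 t, T t & exists S : 'I_(size t) -> set K,
     (forall i, stationary (S i)) /\
     forall al : (size t).-tuple K,
       inj_prod S al -> ~ Psi (matrix_cap a al)).
Proof.
move=> defPsi hp; have [x0] := inhabitedK.
(* Either the rows are constant on a stationary set [S], so that the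
   intersection for [t] does not depend on the tuple, or they are pairwise
   distinct on a club [C]. *)
have [[S stS cst]|[C clC injC]] := constant_or_injective row_code.
  have capE t (al be : (size t).-tuple K) :
      inj_tuples S al -> inj_tuples S be -> matrix_cap a al = matrix_cap a be.
    move=> [_ Sal] [_ Sbe]; apply: eq_bigcapr => n _.
    by rewrite (row_code_inj (cst _ _ (Sal n) (Sbe n))).
  have [good|/existsNP[t /not_implyP[Tt
      /existsNP[al /not_implyP[Sal nPsi]]]]] :=
      pselect (forall t, T t -> forall al : (size t).-tuple K,
                 inj_tuples S al -> Psi (matrix_cap a al)).
    by left; exists S.
  right; exists t => //; exists (fun=> S); split=> // be Sbe.
  by rewrite (capE _ _ _ Sbe Sal).
pose E := [set k | exists2 t, T t & k = test_length t].
have [||[S stS SA]|[k [_ [S [stS SA]]]]] :=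
    hp row_code (trace_class Psi E column_test).
- by move=> s [us _]; split.
- exact: defPsi.
- left; exists (S `&` C) => [|t Tt al [ual Sal]]; first exact: stationaryI.
  have [||||l [sl ul Sl]] := @extend_inj_seq (test_length t)
      (fun=> S `&` C) x0 al.
  + by move=> _; apply: stationaryI.
  + by rewrite size_tuple size_test_length.
  + by [].
  + move=> i; rewrite size_tuple => lt_i.
    by have := Sal (Ordinal lt_i); rewrite (tnth_nth x0).
  have SCl x : x \in al ++ l -> (S `&` C) x.
    move=> /(nthP x0)[i]; rewrite sl => lt_i <-.
    exact: (Sl (Ordinal lt_i)).
  have [|us] := SA (map row_code (al ++ l)).
    split; last by move=> /(congr1 size); rewrite size_map sl.
    split=> [|_ /mapP[x /SCl[Sx _] ->]]; last by exists x.
    by rewrite map_inj_in_uniq// => x y /SCl[_ Cx] /SCl[_ Cy]; apply: injC.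
  rewrite size_map sl (trace_row_code x0 sl) seq_cap_cat ?size_tuple//.
  by rewrite -matrix_capE; apply; exists t.
have stSC i : stationary (S i `&` C) by apply: stationaryI.
have bad l : size l = k -> uniq l ->
    (forall i : 'I_k, (S i `&` C) (nth x0 l i)) ->
    E k /\ ~ Psi (trace column_test (map row_code l)).
  move=> sl ul SCl.
  have sl' : size (map row_code l) == k by rewrite size_map sl.
  have umap : uniq (map row_code l).
    rewrite map_inj_in_uniq// => x y.
    move=> /(nthP x0)[i lt_i <-] /(nthP x0)[j lt_j <-].
    rewrite sl in lt_i lt_j.
    by apply: injC; [case: (SCl (Ordinal lt_i))|case: (SCl (Ordinal lt_j))].
  have := SA (Tuple sl'); rewrite /inj_prod /trace_class /= size_map sl => nA.
  apply/not_implyP => EPsi; apply: nA => //; split=> // i.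
  rewrite (tnth_nth set0) /= (nth_map x0) ?sl//.
  by exists (nth x0 l i) => //; case: (SCl i).
(* The rectangle is nonempty, and any tuple in it shows that [k] is a tested
   length, which singles out [t]. *)
have [||||l [sl ul SCl]] :=
  @extend_inj_seq k (fun i => S i `&` C) x0 [::] => //.
have [[t Tt kE] _] := bad l sl ul SCl.
have le_tk : (size t <= k)%N by rewrite kE size_test_length.
right; exists t => //; exists (fun i => S (widen_ord le_tk i) `&` C).
split=> // al [ual SCal].
have [||||l' [sl' ul' SCl']] := @extend_inj_seq k (fun i => S i `&` C) x0 al.
- by [].
- by rewrite size_tuple.
- by [].
- move=> i; rewrite size_tuple => lt_i.
  have := SCal (Ordinal lt_i); rewrite (tnth_nth x0) /=.
  by rewrite (_ : widen_ord _ _ = i)//; apply: val_inj.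
have [_] := bad _ sl' ul' SCl'.
rewrite (trace_row_code x0 (etrans sl' kE)) seq_cap_cat ?size_tuple//.
by rewrite -matrix_capE.
Qed.

End Matrix.
End Stationary.

Theorem theorem2p7 (d : Order.disp_t) (K : orderType d)
  (hK : regular_uncountable_cardinal K) : HP K -> Cs K /\ Cs_hat K.
Proof.
move=> hp; split=> a T; last first.
  exact: (homogeneity_dichotomy hK a T finite_trace_definable hp).
have [|[t Tt [S [stS capS]]]] :=
  homogeneity_dichotomy hK a T nonempty_trace_definable hp; [by left|right].
exists t => //; exists S; split=> // al Sal.
by apply: contrapT => /eqP/set0P; apply: capS.
Qed.
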